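(* Let $\mathcal{X}$ be an infinite dimensional complex Banach space and let $T\in\mathcal{B}(\mathcal{X})$ satisfy the generalized Browder's theorem, i.e. $\sigma(T)\setminus\sigma_{BW}(T)=p_0(T)$. The following statements are equivalent: (i) $T$ satisfies the generalized Weyl's theorem, i.e. $\sigma(T)\setminus\sigma_{BW}(T)=\pi_0(T)$; (ii) $\sigma_{BW}(T)\cap\pi_0(T)=\emptyset$; (iii) $p_0(T)=\pi_0(T)$.
   Context: $\mathcal{B}(\mathcal{X})$ is the algebra of bounded linear operators on $\mathcal{X}$. $N(T)$, $R(T)$ denote null space and range; $T$ is Fredholm if $\dim N(T)<\infty$ and $\dim\mathcal{X}/R(T)<\infty$ (and $R(T)$ is closed), with index $i(T)=\dim N(T)-\dim\mathcal{X}/R(T)$. For a nonnegative integer $n$, $T_{[n]}$ is the restriction of $T$ to $R(T^n)$, viewed as a map from $R(T^n)$ into $R(T^n)$ ($T_{[0]}=T$). $T$ is $B$-Fredholm if for some $n$ the range $R(T^n)$ is closed and $T_{[n]}$ is Fredholm. The degree of stable iteration of $T$ is $d=\operatorname{dis}T:=\inf\{n\in\mathbb{Z}_+: m\in\mathbb{Z}_+, m\ge n\Rightarrow R(T^n)\cap N(T)\subseteq R(T^m)\cap N(T)\}$; for $B$-Fredholm $T$ the index is $i(T):=i(T_{[d]})$ (and $i(T_{[m]})=i(T_{[d]})$ for all $m\ge d$). $T$ is $B$-Weyl if it is $B$-Fredholm of index $0$. $\sigma_{BW}(T)=\{\lambda\in\mathbb{C}: T-\lambda\text{ is not }B\text{-Weyl}\}$.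 $\sigma(T)$ is the spectrum; $p_0(T)$ is the set of poles (of the resolvent) of $T$; $\pi_0(T)$ is the set of all eigenvalues of $T$ which are isolated points of $\sigma(T)$. *)

(* Defs.v *)
From HB Require Import structures.
From mathcomp Require Import all_boot all_order all_algebra.
From mathcomp Require Export complex.
From mathcomp Require Export all_classical all_reals all_analysis.
Set Implicit Arguments.
Unset Strict Implicit.
Unset Printing Implicit Defensive.
Import Order.TTheory GRing.Theory Num.Theory.
Import numFieldNormedType.Exports.
Local Open Scope classical_set_scope.
Local Open Scope ring_scope.
Local Open Scope complex_scope.

Section LinearAlgebra.
Variables (K : fieldType) (X : lmodType K).
Implicit Types (V W : set X) (f : X -> X).

Definition null_space f : set X := [set x | f x = 0].

(** [b] represents a basis of the quotient [V / W] of two linear subspaces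
    [W `<=` V] of [X]: each vector of [V] has unique coordinates modulo [W]. *)
Definition quot_basis V W n (b : 'I_n -> X) : Prop :=
  (forall i, V (b i)) /\
  forall x, V x -> exists! c : {ffun 'I_n -> K}, W (x - \sum_(i < n) c i *: b i).

Definition quot_has_dim V W (n : nat) : Prop :=
  exists b : 'I_n -> X, quot_basis V W b.

Definition quot_fin_dim V W : Prop := exists n, quot_has_dim V W n.

(** Dimension of [V / W]; the value is 0 when this is not finite-dimensional. *)
Definition quot_dim V W : nat := xget 0%N [set n | quot_has_dim V W n].

(** The dimension of [V] itself is the case [W = [set 0]]. *)
Definition fin_dim V : Prop := quot_fin_dim V [set 0].
Definition dim V : nat := quot_dim V [set 0].

(** Index of the map [V -> V] induced by [f], where [f @` V `<=` V]. *)
Definition index_on f V : int :=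
  (dim (V `&` null_space f))%:Z - (quot_dim V (f @` V))%:Z.

Definition range_iter f n : set X := range (iter n f).

Definition stable_iteration f : set nat :=
  [set n | forall m, (n <= m)%N ->
    range_iter f n `&` null_space f `<=` range_iter f m `&` null_space f].

(** Infimum of [stable_iteration f]; the value is 0 instead of +oo when that
    set is empty, which does not occur for a B-Fredholm operator. *)
Definition dis f : nat :=
  xget 0%N [set d | stable_iteration f d /\
                    forall n, stable_iteration f n -> (d <= n)%N].

End LinearAlgebra.

(** [R[i]] packaged as a [numClosedFieldType], from which it gets the
    topology given by its norm. *)
Definition complexes (R : realType) : numClosedFieldType := R[i].

Section Operators.
Variables (R : realType).
Notation C := (complexes R).
Variable X : completeNormedModType C.
Implicit Types (T : {linear X -> X}) (f : X -> X) (V : set X) (l : C).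

Definition bounded_op T : Prop := exists M : C, forall x, `|T x| <= M * `|x|.

(** The map [V -> V] induced by [f] is Fredholm, where [f @` V `<=` V]; its
    range has to be closed in the subspace topology of [V]. *)
Definition Fredholm_on f V : Prop :=
  [/\ fin_dim (V `&` null_space f),
      quot_fin_dim V (f @` V) &
      V `&` closure (f @` V) `<=` f @` V].

(** The map induced by [f] on [range_iter f n] is the restriction written
    T_[n] for [f = T]. *)
Definition B_Fredholm f : Prop :=
  exists n, closed (range_iter f n) /\ Fredholm_on f (range_iter f n).

Definition B_index f : int := index_on f (range_iter f (dis f)).

Definition B_Weyl f : Prop := B_Fredholm f /\ B_index f = 0.

Definition shift T l : X -> X := fun x => T x - l *: x.

Definition sigma_BW T : set C := [set l | ~ B_Weyl (shift T l)].

Definition bounded_inverse f T : Prop :=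
  [/\ bounded_op T, cancel f T & cancel T f].

Definition spectrum T : set C :=
  [set l | ~ exists S : {linear X -> X}, bounded_inverse (shift T l) S].

(** Complex differentiability at [l], in operator norm, of an operator-valued
    function: the difference quotients tend to a bounded operator [D]. *)
Definition op_differentiable (G : C -> {linear X -> X}) l : Prop :=
  exists2 D : {linear X -> X}, bounded_op D &
    forall e : C, 0 < e -> \forall h \near 0^', forall x : X,
      `|h^-1 *: (G (l + h) x - G l x) - D x| <= e * `|x|.

(** The resolvent [z |-> (z - T)^-1] has a pole of order [k] at [l]: on a
    punctured neighbourhood of [l] it is [(z - l)^-k G(z)], where [G] is
    holomorphic on a neighbourhood of [l] and [G(l) <> 0]. *)
Definition resolvent_pole T l (k : nat) : Prop :=
  exists G : C -> {linear X -> X},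
    [/\ \forall z \near l, bounded_op (G z) /\ op_differentiable G z,
        exists x, G l x <> 0 &
        \forall z \near l^',
          bounded_inverse (fun x => z *: x - T x) ((z - l) ^- k \*: G z)].

(** p_0(T) *)
Definition poles T : set C :=
  [set l | isolated (spectrum T) l /\
           exists2 k, (0 < k)%N & resolvent_pole T l k].

Definition eigenvalues T : set C :=
  [set l | exists2 x : X, x <> 0 & T x = l *: x].

(** pi_0(T) *)
Definition isolated_eigenvalues T : set C :=
  eigenvalues T `&` isolated (spectrum T).

Definition generalized_Browder T : Prop :=
  spectrum T `\` sigma_BW T = poles T.

Definition generalized_Weyl T : Prop :=
  spectrum T `\` sigma_BW T = isolated_eigenvalues T.

End Operators.

(* Main.v *)
(** The only analytic fact is that a pole of the resolvent is an eigenvalue: if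
    [(z - T)^-1 = (z - l)^-k G(z)] with [k > 0], then
    [(z - T) G(z) y = (z - l)^k y], and letting [z --> l] gives
    [(l - T) G(l) y = 0], where [G(l) y <> 0] for some [y].  Hence
    [p_0(T) `<=` pi_0(T)], and the rest is set algebra with
    [pi_0(T) `<=` sigma(T)]. *)
Require Import Defs.
From mathcomp Require Import all_boot all_order all_algebra.
From mathcomp Require Import complex.
From mathcomp Require Import all_classical all_reals all_analysis.
Import Order.TTheory GRing.Theory Num.Theory.
Import numFieldNormedType.Exports.
Local Open Scope classical_set_scope.
Local Open Scope ring_scope.
Local Open Scope complex_scope.

Lemma numField_exprn_continuous (K : numFieldType) n :
  continuous (fun z : K => z ^+ n).
Proof.
by move=> z; apply/differentiable_continuous/derivable1_diffP/exprn_derivable.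
Qed.

Section BoundedOperators.
Context {R : realType} {X : completeNormedModType (complexes R)}.
Implicit Types T : {linear X -> X}.

Lemma bounded_op_continuous T : bounded_op T -> continuous T.
Proof.
move=> [M TM] x.
(* [M] is a complex number under a partial order. Since [M * |y|] dominates a norm, it equals
   [|M| * |y|]; the added 1 makes the bound positive, so that one can divide by it. *)
have {}TM y : `|T y| <= (`|M| + 1) * `|y|.
  have : 0 <= M * `|y| by apply: le_trans (TM y).
  move=> /ger0_norm; rewrite normrM normr_id => E.
  by rewrite mulrDl E mul1r (le_trans (TM y)) // lerDl.
have M1 : 0 < `|M| + 1 by rewrite ltr_wpDl.
apply/cvgrPdist_le => e e0; near=> y.
rewrite -linearB (le_trans (TM _)) // mulrC -ler_pdivlMr //.
by near: y; apply: cvgr_dist_le; [exact: cvg_id | rewrite divr_gt0].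
Unshelve. all: by end_near. Qed.

(** The operator-norm estimate evaluated at [y] makes [G z y] differentiable in [z] at [l], with
    derivative [D y]. *)
Lemma op_differentiable_continuous (G : complexes R -> {linear X -> X}) l y :
  op_differentiable G l -> {for l, continuous (fun z => G z y)}.
Proof.
move=> [D _ GD].
apply/differentiable_continuous/derivable1_diffP.
apply/cvg_ex; exists (D y); apply/cvgrPdist_le => e e0.
(* The 1 keeps the divisor positive when [y = 0]. *)
have y1 : 0 < `|y| + 1 by rewrite ltr_wpDl.
have := GD (e / (`|y| + 1)) (divr_gt0 e0 y1).
apply: filterS => h /(_ y) /= Gh.
rewrite distrC [h *: 1]mulr1 [h + l]addrC (le_trans Gh) //.
by rewrite mulrAC ler_pdivrMr // ler_wpM2l ?lerDl // ltW.
Qed.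

Lemma resolvent_pole_eigenvalue T l k : bounded_op T -> (0 < k)%N ->
  resolvent_pole T l k -> eigenvalues T l.
Proof.
move=> Tb k0 [G [Gdiff [y Gly] Ginv]]; exists (G l y) => //.
have Gcont : {for l, continuous (fun z => G z y)}.
  by apply: op_differentiable_continuous; have [] := nbhs_singleton Gdiff.
(* The limit is taken over [l^'], where the resolvent identity holds: [GT] finds it by continuity,
   [G0] from that identity. *)
have GT : (fun z => z *: G z y - T (G z y)) @ l^' --> l *: G l y - T (G l y).
  apply: (cvg_trans (cvg_app _ (@nbhs_dnbhs _ l))).
  apply: cvgB; first by apply: cvgZ => //; exact: cvg_id.
  exact: (cvg_comp _ _ Gcont (bounded_op_continuous _ Tb _)).
have G0 : (fun z => z *: G z y - T (G z y)) @ l^' --> (0 : X).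
  have : (fun z => (z - l) ^+ k *: y) @ l^' --> (0 : X).
    apply: (cvg_trans (cvg_app _ (@nbhs_dnbhs _ l))).
    (* Here [k > 0] is essential, as [0 ^+ 0 = 1]. *)
    have -> : (0 : X) = (l - l) ^+ k *: y.
      by rewrite subrr expr0n gtn_eqF // scale0r.
    apply: cvgZr_tmp; apply: (cvg_comp (fun z => z - l) (fun z => z ^+ k)).
      by apply: cvgB; [exact: cvg_id | exact: cvg_cst].
    exact: numField_exprn_continuous.
  apply: cvg_trans; apply: near_eq_cvg; near=> z.
  have zl : (z - l) ^+ k != 0.
    rewrite expf_neq0 // subr_eq0; near: z; exact: nbhs_dnbhs_neq.
  (* [E] is the right-inverse identity at [y]; linearity of [T] lets the nonzero scalar
     [(z - l) ^+ k] cancel its inverse. *)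
  have [_ _ /(_ y) /= E] : bounded_inverse (fun x => z *: x - T x)
    ((z - l) ^- k \*: G z) by near: z.
  rewrite -[in LHS]E [T _]linearZ /= scalerA [z * _]mulrC -scalerA -scalerBr.
  by rewrite scalerA divff // scale1r.
(* Uniqueness of the limit rests on [l^'] being a proper filter: [l] is not isolated in the complex
   plane. *)
by apply/esym/eqP; rewrite -subr_eq0; apply/eqP; exact: norm_cvg_unique GT G0.
Unshelve. all: by end_near. Qed.

Lemma poles_sub_isolated_eigenvalues T :
  bounded_op T -> poles T `<=` isolated_eigenvalues T.
Proof.
by move=> Tb l [iso [k k0 /(resolvent_pole_eigenvalue _ _ _ Tb k0)]].
Qed.

End BoundedOperators.

Theorem theorem2p4 (R : realType) (X : completeNormedModType (complexes R))
    (hX : ~ fin_dim [set: X]) (T : {linear X -> X}) (hT : bounded_op T)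
    (hgB : generalized_Browder T) :
  (generalized_Weyl T <-> sigma_BW T `&` isolated_eigenvalues T = set0) /\
  (sigma_BW T `&` isolated_eigenvalues T = set0 <->
     poles T = isolated_eigenvalues T).
Proof.
(* Under [hgB] both sides are the same equation. *)
have GW_poles : generalized_Weyl T <-> poles T = isolated_eigenvalues T.
  by rewrite /generalized_Weyl hgB.
have disj_poles : sigma_BW T `&` isolated_eigenvalues T = set0 <->
    poles T = isolated_eigenvalues T.
  split=> [disj | <-]; last by rewrite -hgB setIC setDKI.
  apply/seteqP; split; first exact: poles_sub_isolated_eigenvalues.
  (* By [hgB], being a pole means lying in the spectrum but outside [sigma_BW T]; [disj] gives the
     latter. *)
  move=> l pil; rewrite -hgB; split; first by case: pil => _ /isolatedS.
  by move=> BWl; have : set0 l by rewrite -disj.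
by split; [rewrite GW_poles disj_poles | ].
Qed.
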